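(* There exists a countably generated simple complete Boolean algebra.
   Context: An atomless complete Boolean algebra $B$ is called simple if it has no atomless complete subalgebra $A$ such that $A\neq B$. (A complete subalgebra of $B$ is a subalgebra closed under arbitrary sums and products as computed in $B$.) A complete Boolean algebra $B$ is countably generated if there is a countable set $S\subseteq B$ such that the smallest complete subalgebra of $B$ containing $S$ is $B$ itself. *)

(* Defs.v *)
From HB Require Import structures.
From mathcomp Require Import all_boot all_order.
From mathcomp Require Import boolp classical_sets functions cardinality.
Set Implicit Arguments.
Unset Strict Implicit.
Unset Printing Implicit Defensive.
Import Order.TTheory.
Local Open Scope order_scope.
Local Open Scope classical_set_scope.

(* Boolean algebras are represented by [ctbDistrLatticeType]; this interface
   allows [\bot = \top], so nontriviality is required explicitly in [simple_cBA]
   (the one-point algebra has no atoms).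
   [supremums S] and [infimums S] are the sets, with at most one element, of
   least upper bounds and of greatest lower bounds of [S]. *)

Definition complete_BA d (B : ctbDistrLatticeType d) : Prop :=
  forall S : set B, supremums S !=set0 /\ infimums S !=set0.

Definition subalgebra d (B : ctbDistrLatticeType d) (A : set B) : Prop :=
  [/\ A \bot, A \top,
      forall x y, A x -> A y -> A (x `&` y)%O,
      forall x y, A x -> A y -> A (x `|` y)%O &
      forall x, A x -> A (~` x)%O].

(* Suprema and infima are those of [B], not those of the ordered set [A]. *)
Definition complete_subalgebra d (B : ctbDistrLatticeType d) (A : set B) : Prop :=
  subalgebra A /\
  forall S : set B, S `<=` A -> supremums S `<=` A /\ infimums S `<=` A.

(* Atoms are relative to the subalgebra [A]: an atom of [A] need not be an atom
   of [B]. *)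
Definition is_atom d (B : ctbDistrLatticeType d) (A : set B) (a : B) : Prop :=
  [/\ A a, a <> \bot & forall x, A x -> x <= a -> x = \bot \/ x = a].

Definition atomless d (B : ctbDistrLatticeType d) (A : set B) : Prop :=
  forall a, ~ is_atom A a.

Definition simple_cBA d (B : ctbDistrLatticeType d) : Prop :=
  [/\ complete_BA B, (\bot : B) <> \top, atomless [set: B] &
      ~ exists A : set B,
          [/\ complete_subalgebra A, atomless A & A <> [set: B]]].

Definition countably_generated d (B : ctbDistrLatticeType d) : Prop :=
  exists2 S : set B,
    countable S & smallest (@complete_subalgebra d B) S = [set: B].

(* Main.v *)
Require Import Defs.
From HB Require Import structures.
From mathcomp Require Import all_boot all_order.
From mathcomp Require Import boolp classical_sets cardinality.

(** The algebra is the regular open algebra of a forcing with finitely branching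
    trees, in the manner of Sacks forcing.  It is generated by the countably many
    elements [cone u] (the generic branch passes through the node u), so it is
    enough that an atomless complete subalgebra A contains every cone.

    Two fusion arguments show this.  As A has no atoms, any two conditions have
    extensions told apart by an element of A; fusing this over all splitting
    nodes ([separating_tree]) gives below any q0 a tree q whose generic branch can
    be read off from A.  If cone u were not in A, such a q outside the cone and
    some tree p inside it would be linked by A: conditions below p would give
    information on the branch through q.

    The growth of the tree forbids such a link.  The nodes are enumerated, and
    the number of children of the k-th node is so large compared with the numbers
    of children of the earlier nodes that a tree which does not split at the k-th
    node can be thinned to one leaving few possible values for any name of a
    child of that node ([bounding]).  Trees inside the cone and trees outside it
    never split at the same node.  So some p' inside p allows the branch through q
    few children at every node, whereas a condition below q that forces every
    element of A forced by p' has many children at some node ([trees_simple]). *)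

Set Implicit Arguments.
Unset Strict Implicit.
Unset Printing Implicit Defensive.
Import Order.Theory.
Local Open Scope classical_set_scope.

(** * Regular open algebra of a forcing notion *)

Record forcing := Forcing {
  condition :> Type;
  stronger : condition -> condition -> Prop;
  stronger_refl : forall p, stronger p p;
  stronger_trans : forall p q r, stronger p q -> stronger q r -> stronger p r }.

Notation "q ≼ p" := (stronger q p) (at level 70, no associativity).

(** Regular open for the topology on P whose open sets are the downward closed
    ones: one direction gives downward closure, the other that a set which is
    dense below p contains p.  Read [a p] as: p forces that the generic filter
    meets a. *)
Definition regular_open (P : forcing) (U : set P) : Prop :=
  forall p, U p <-> forall q, q ≼ p -> exists2 r, r ≼ q & U r.

Record regopen (P : forcing) := RegOpen {
  regopen_set :> condition P -> Prop;
  regopenP : regular_open regopen_set }.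

Section RegularOpenAlgebra.
Context (P : forcing).
Implicit Types (p q r : P) (a b c : regopen P).

HB.instance Definition _ := gen_eqMixin (regopen P).
HB.instance Definition _ := gen_choiceMixin (regopen P).

Lemma regopen_down a p q : q ≼ p -> a p -> a q.
Proof.
move=> qp /regopenP ap; apply/regopenP => r rq.
by apply: ap; apply: stronger_trans qp.
Qed.

Lemma regopen_dense a p :
  (forall q, q ≼ p -> exists2 r, r ≼ q & a r) -> a p.
Proof. by move=> h; apply/regopenP. Qed.

Lemma regopen_ext a b : (forall p, a p <-> b p) -> a = b.
Proof.
case: a b => [U Ur] [V Vr] /= UV.
have E : U = V by apply/seteqP; split=> p /UV.
by case: V / E Vr {UV} => Vr; congr RegOpen; apply: Prop_irrelevance.
Qed.

Definition ro_le a b := `[< regopen_set a `<=` b >].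

Fact ro_le_refl : reflexive ro_le.
Proof. by move=> a; apply/asboolP. Qed.

Fact ro_le_anti : antisymmetric ro_le.
Proof.
move=> a b /andP[/asboolP ab /asboolP ba].
by apply: regopen_ext => p; split; [apply: ab|apply: ba].
Qed.

Fact ro_le_trans : transitive ro_le.
Proof.
by move=> b a c /asboolP ab /asboolP bc; apply/asboolP; apply: subset_trans bc.
Qed.

Fact ro_disp : Order.disp_t. Proof. exact: (Order.Disp tt tt). Qed.

HB.instance Definition _ :=
  Order.Le_isPOrder.Build ro_disp (regopen P) ro_le_refl ro_le_anti ro_le_trans.

Lemma ro_leP a b : reflect (forall p, a p -> b p) (a <= b)%O.
Proof. exact: asboolP. Qed.

(** The conditions below which U is dense: the interior of the closure of U. *)
Fact regularize_subproof (U : set P) :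
  (forall p q, q ≼ p -> U p -> U q) ->
  regular_open [set p | forall q, q ≼ p -> exists2 r, r ≼ q & U r].
Proof.
move=> Ud p; split=> [h q qp|h q qp].
  by exists q; [exact: stronger_refl|move=> r rq; apply: h (stronger_trans rq qp)].
have [r rq /(_ r (stronger_refl r))[s sr Us]] := h q qp.
by exists s => //; apply: stronger_trans sr rq.
Qed.

Fact ro_meet_subproof a b : regular_open (regopen_set a `&` b).
Proof.
move=> p; split=> [[ap bp] q qp|h].
  exists q; first exact: stronger_refl.
  by split; apply: regopen_down qp _.
by split; apply: regopen_dense => q /h[r rq []]; exists r.
Qed.
Definition ro_meet a b := RegOpen (ro_meet_subproof a b).

Fact ro_join_subproof a b :
  regular_open [set p | forall q, q ≼ p -> exists2 r, r ≼ q & a r \/ b r].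
Proof.
apply: (@regularize_subproof [set p | a p \/ b p]) => p q qp /= [?|?];
  by [left; apply: regopen_down qp _|right; apply: regopen_down qp _].
Qed.
Definition ro_join a b := RegOpen (ro_join_subproof a b).

Fact ro_compl_subproof a : regular_open [set p | forall q, q ≼ p -> ~ a q].
Proof.
move=> p; split=> [h q qp|h q qp aq] /=.
  exists q; first exact: stronger_refl.
  by move=> r rq; apply: h; apply: stronger_trans qp.
have [r rq] := h q qp.
move=> /(_ r (stronger_refl r)); apply; exact: regopen_down aq.
Qed.
Definition ro_compl a := RegOpen (ro_compl_subproof a).

Fact ro_bot_subproof : regular_open (@set0 P).
Proof.
by move=> p; split=> // /(_ p (stronger_refl p))[].
Qed.
Definition ro_bot := RegOpen ro_bot_subproof.

Fact ro_top_subproof : regular_open (@setT P).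
Proof. by move=> p; split=> // _ q _; exists q => //; apply: stronger_refl. Qed.
Definition ro_top := RegOpen ro_top_subproof.

Fact ro_lexI a b c : (a <= ro_meet b c)%O = (a <= b)%O && (a <= c)%O.
Proof.
apply/ro_leP/andP => [h|[/ro_leP ab /ro_leP ac] p ap].
  by split; apply/ro_leP => p /h[].
by split; [apply: ab|apply: ac].
Qed.

Fact ro_leUx a b c : (ro_join a b <= c)%O = (a <= c)%O && (b <= c)%O.
Proof.
apply/ro_leP/andP => [h|[/ro_leP ac /ro_leP bc] p abp].
  split; apply/ro_leP => p ap; apply: h => q qp; exists q;
    rewrite ?(regopen_down qp ap); try exact: stronger_refl.
    by left; apply: regopen_down ap.
  by right; apply: regopen_down ap.
apply: regopen_dense => q /abp[r rq [/ac|/bc]]; by exists r.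
Qed.

HB.instance Definition _ := Order.POrder_MeetJoin_isLattice.Build ro_disp
  (regopen P) ro_lexI ro_leUx.

Fact ro_meetUl : left_distributive ro_meet ro_join.
Proof.
move=> a b c; apply: regopen_ext => p; split=> /= [[abp cp] q qp|h].
  have [r rq abr] := abp q qp.
  have cr : c r by apply: regopen_down cp; apply: stronger_trans qp.
  by exists r => //; case: abr; [left|right].
split=> [q /h[r rq abr]|].
  by exists r => //; case: abr => -[? ?]; [left|right].
by apply: regopen_dense => q /h[r rq abr]; exists r => //; case: abr => -[].
Qed.

HB.instance Definition _ := Order.Lattice_Meet_isDistrLattice.Build ro_disp
  (regopen P) ro_meetUl.

Fact ro_le0x a : (ro_bot <= a)%O.
Proof. exact/ro_leP. Qed.
HB.instance Definition _ := Order.hasBottom.Build ro_disp (regopen P) ro_le0x.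

Fact ro_lex1 a : (a <= ro_top)%O.
Proof. exact/ro_leP. Qed.
HB.instance Definition _ := Order.hasTop.Build ro_disp (regopen P) ro_lex1.

Fact ro_joinxC a : ro_join a (ro_compl a) = ro_top.
Proof.
apply: regopen_ext => p; split=> //= _ q _.
case: (pselect (exists2 r, r ≼ q & a r)) => [[r rq ar]|na].
  by exists r => //; left.
exists q; first exact: stronger_refl.
by right=> r rq ar; apply: na; exists r.
Qed.

Fact ro_meetxC a : ro_meet a (ro_compl a) = ro_bot.
Proof.
apply: regopen_ext => p; split=> //= -[ap].
by move=> /(_ p (stronger_refl p)).
Qed.

HB.instance Definition _ :=
  Order.TBDistrLattice_hasComplement.Build ro_disp (regopen P)
    ro_joinxC ro_meetxC.

Lemma ro_complP a p : (~` a)%O p <-> forall q, q ≼ p -> ~ a q.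
Proof. by []. Qed.

Fact ro_inf_subproof (S : set (regopen P)) :
  regular_open [set p | forall a, S a -> a p].
Proof.
move=> p; split=> [h q qp|h a Sa].
  exists q; first exact: stronger_refl.
  by move=> a Sa; apply: regopen_down qp _; apply: h.
by apply: regopen_dense => q /h[r rq]; exists r; auto.
Qed.
Definition ro_inf S := RegOpen (@ro_inf_subproof S).

Lemma ro_infP S : infimums S (ro_inf S).
Proof.
split=> [a Sa|b bS]; apply/ro_leP => p; first by apply.
by move=> bp a Sa; move/ro_leP: (bS a Sa); apply.
Qed.

Lemma regopen_complete : complete_BA (regopen P).
Proof.
move=> S; split; last by exists (ro_inf S); apply: ro_infP.
exists (ro_inf (ubound S)); split=> [a Sa|b Sb]; apply/ro_leP => p.
  by move=> ap b /(_ a Sa)/ro_leP; apply.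
by apply.
Qed.

Fact hull_subproof p :
  regular_open [set q | forall r, r ≼ q -> exists2 s, s ≼ r & s ≼ p].
Proof.
apply: (@regularize_subproof [set q | q ≼ p]) => q r rq /= qp.
exact: stronger_trans qp.
Qed.
(** The canonical map from conditions to the algebra; its values are dense, and
    by [hull_leP] forcing a is the same as having hull below a. *)
Definition hull p := RegOpen (hull_subproof p).

Lemma hullxx p : hull p p.
Proof. by move=> q qp; exists q; first exact: stronger_refl. Qed.

Lemma hull_leP p a : (hull p <= a)%O <-> a p.
Proof.
split=> [/ro_leP|ap]; first by apply; apply: hullxx.
apply/ro_leP => q pq; apply: regopen_dense => r /pq[s sr sp].
by exists s => //; apply: regopen_down ap.
Qed.

Lemma not_in_regopen a p : ~ a p -> exists2 q, q ≼ p & (~` a)%O q.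
Proof.
move=> nap; apply: contrapT => h; apply: nap; apply: regopen_dense => q qp.
apply: contrapT => k; apply: h; exists q => //; apply/ro_complP => r rq ar.
by apply: k; exists r.
Qed.

Lemma regopen_compl_absurd a p : a p -> (~` a)%O p -> False.
Proof. by move=> ap /ro_complP/(_ p (stronger_refl p)). Qed.

End RegularOpenAlgebra.

(** The projection of x to A: the infimum, computed in B, of the elements of A
    above x.  Completeness of A puts it in A. *)
Lemma complete_subalgebra_envelope d (B : ctbDistrLatticeType d) (A : set B) x :
  complete_BA B -> complete_subalgebra A ->
  exists c, [/\ A c, (x <= c)%O & forall a, A a -> (x <= a)%O -> (c <= a)%O].
Proof.
move=> cB [_ cA].
have [_ [c cinf]] := cB [set a | A a /\ (x <= a)%O].
exists c; case: (cinf) => clb cglb; split.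
- by have [_] := cA [set a | A a /\ (x <= a)%O] (fun a => @proj1 _ _); apply.
- by apply: cglb => a [].
- by move=> a Aa xa; apply: clb.
Qed.

Section Separation.
Context (P : forcing) (A : set (regopen P)).
Context (cA : complete_subalgebra A).
Implicit Types (p q r : P) (a b c : regopen P).

(** The trace of p on A.  It turns facts about what p forces into inequalities
    inside A, which is how information passes between two disjoint conditions. *)
Lemma envelope p :
  exists c, [/\ A c, c p & forall a, A a -> a p -> (c <= a)%O].
Proof.
have [c [Ac /hull_leP cp cmin]] :=
  complete_subalgebra_envelope (hull p) (@regopen_complete P) cA.
by exists c; split=> // a Aa ap; apply: cmin => //; apply/hull_leP.
Qed.

Lemma subalgebra_compl a : A a -> A (~` a)%O.
Proof. by case: cA => -[_ _ _ _ h] _; apply: h. Qed.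

(** The generic filter of A already distinguishes p from q. *)
Definition separated p q := exists a, [/\ A a, a p & (~` a)%O q].

Lemma separated_down p q p' q' :
  p' ≼ p -> q' ≼ q -> separated p q -> separated p' q'.
Proof.
move=> pp qq [a [Aa ap aq]]; exists a; split=> //; first exact: regopen_down ap.
exact: regopen_down aq.
Qed.

Lemma separated_sym p q : separated p q -> separated q p.
Proof.
move=> [a [Aa ap aq]]; exists (~` a)%O; rewrite complK; split=> //.
exact: subalgebra_compl.
Qed.

(** If p decided every element of A, its envelope would be an atom of A.  So some
    a in A is undecided by p; whichever side of a is compatible with q, p can be
    sent to the other one. *)
Lemma separated_dense p q : atomless A ->
  exists p' q', [/\ p' ≼ p, q' ≼ q & separated p' q'].
Proof.
move=> atA.
have [a Aa [[p1 p1p ap1] [p2 p2p ap2]]] : exists2 a, A a &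
    (exists2 p', p' ≼ p & a p') /\ (exists2 p', p' ≼ p & (~` a)%O p').
  apply: contrapT => h.
  have dec a : A a -> a p \/ (~` a)%O p.
    move=> Aa; case: (pselect (a p)) => [|/not_in_regopen[q2 q2p aq2]]; [by left|].
    right; apply/ro_complP => q1 q1p aq1; apply: h; exists a => //.
    by split; [exists q1|exists q2].
  have [c [Ac cp cmin]] := envelope p.
  apply: (atA c); split=> //.
    by move=> cbot; move: cp; rewrite cbot.
  move=> x Ax xc; case: (dec x Ax) => [xp|xp]; [right|left].
    by apply/le_anti; rewrite xc cmin.
  have /(le_trans xc)/meet_idPl <- := cmin _ (subalgebra_compl Ax) xp.
  exact: meetxC.
case: (pselect (exists2 q', q' ≼ q & a q')) => [[q' q'q aq']|nq].
  exists p2, q'; split=> //; apply: separated_sym.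
  by exists a.
exists p1, q; split=> //; first exact: stronger_refl.
exists a; split=> //; apply/ro_complP => r rq ar.
by apply: nq; exists r.
Qed.
End Separation.

(** * Trees with rapidly growing widths *)

(** Nodes are stored last entry first: [i :: s] is the i-th child of s, and s lies
    on the way from the root to t when s is a [suffix] of t. *)
Definition node := seq nat.

Implicit Types (s t u : node).

Definition compatible s t := suffix s t || suffix t s.

Lemma suffix_consE s i t : suffix s (i :: t) = (s == i :: t) || suffix s t.
Proof.
apply/idP/idP => [/suffixP[[|j w] /=]|/predU1P[->|]].
- by move->; rewrite eqxx.
- by case=> _ ->; rewrite suffix_suffix orbT.
- exact: suffix_refl.
- exact: (@suffix_catr _ _ _ [:: i]).
Qed.

Lemma suffix_compatible s t u : suffix s u -> suffix t u -> compatible s t.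
Proof.
elim: u => [|i u IH]; first by rewrite !suffixs0 => /eqP-> /eqP->.
rewrite !suffix_consE => /predU1P[->|su] /predU1P[->|tu].
- by rewrite /compatible suffix_refl.
- by rewrite /compatible (@suffix_catr _ _ _ [:: i]) ?orbT.
- by rewrite /compatible (@suffix_catr _ _ _ [:: i]).
- exact: IH.
Qed.

Lemma compatible_sym s t : compatible s t = compatible t s.
Proof. exact: orbC. Qed.

Lemma suffix_antisym s t : suffix s t -> suffix t s -> s = t.
Proof.
move=> /suffixP[w ->] /size_suffix; rewrite size_cat -{2}(add0n (size s)).
by rewrite leq_add2r; case: w.
Qed.

Lemma suffix_child s t : suffix s t -> s <> t -> exists i, suffix (i :: s) t.
Proof.
move=> /suffixP[w ->]; elim/last_ind: w => // w i _ _.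
by exists i; rewrite cat_rcons suffix_suffix.
Qed.

(** A node properly above s passes through exactly one child of s. *)
Lemma compatible_children i j s t :
  compatible (i :: s) t -> compatible (j :: s) t -> suffix s t -> s <> t ->
  i = j.
Proof.
move=> is_ js st nst; have [k kst] := suffix_child st nst.
suff H l : compatible (l :: s) t -> l = k by rewrite (H _ is_) (H _ js).
move=> /orP[lst|tls].
  have /orP[] := suffix_compatible lst kst; rewrite suffix_consE => /predU1P[|/size_suffix];
    by [case|rewrite /= ltnn].
move: tls; rewrite suffix_consE => /predU1P[tE|/(suffix_antisym st)//].
move: kst; rewrite tE suffix_consE => /predU1P[[]//|/size_suffix].
by rewrite /= ltnn.
Qed.

(** [bound k] exceeds every count arising from the nodes of index below k: it
    bounds the product of their widths (the number of ways to colour them) and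
    1 plus the sum of their widths (the size of a front of a tree that splits only
    at such nodes before this front).  The node of index k has [width k] children,
    just over the k-th power of [bound k].  The value 2 at 0 makes every bound
    exceed 1, so that powers are strictly monotone. *)
Fixpoint bound k := if k is j.+1 then bound j * (bound j ^ j).+2 else 2.
Definition width k := (bound k ^ k).+1.
Definition index_of s := pickle s.
Definition slack s := bound (index_of s).
Definition arity s := width (index_of s).

Lemma bound_gt1 k : 1 < bound k.
Proof.
elim: k => // k IH /=; apply: (leq_trans IH).
by rewrite leq_pmulr.
Qed.

(** The norm of the set of children of t, as a logarithm in base [slack t].
    Colouring the children with at most [slack t] colours costs one unit of norm,
    and norm 1 forbids having only [slack t] children. *)
Definition wide n (p : node -> Prop) t := exists K : seq nat,
  [/\ uniq K, slack t ^ n < size K & forall i, i \in K -> p (i :: t)].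

Definition is_tree (p : node -> Prop) :=
  [/\ p [::],
      forall i s, p (i :: s) -> p s /\ i < arity s &
      forall n s, p s -> exists2 t, suffix s t & wide n p t].

Record tree := Tree { tree_set :> node -> Prop; treeP : is_tree tree_set }.

Fact tree_refl (p : tree) s : p s -> p s. Proof. by []. Qed.
Fact tree_trans (p q r : tree) :
  (forall s, p s -> q s) -> (forall s, q s -> r s) -> forall s, p s -> r s.
Proof. by move=> pq qr s ps; apply: qr (pq _ ps). Qed.

Canonical tree_forcing := @Forcing tree
  (fun q p => forall s, q s -> p s) tree_refl tree_trans.

Implicit Types (p q r : tree).

Lemma tree_root p : p [::]. Proof. by case: (treeP p). Qed.

Lemma tree_arity p i s : p (i :: s) -> i < arity s.
Proof. by case: (treeP p) => _ h _ /h[]. Qed.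

Lemma tree_suffix p s t : suffix s t -> p t -> p s.
Proof.
move=> /suffixP[w ->]; elim: w => //= i w IH.
by case: (treeP p) => _ h _ /h[/IH].
Qed.

Lemma tree_wide p n s : p s -> exists2 t, suffix s t & wide n p t.
Proof. by case: (treeP p) => _ _; apply. Qed.

Lemma wide_le n m (p : node -> Prop) t : n <= m -> wide m p t -> wide n p t.
Proof.
move=> nm [K [Ku Ks Kp]]; exists K; split=> //; apply: leq_ltn_trans Ks.
by rewrite leq_exp2l // bound_gt1.
Qed.

Lemma wide_sub n (p q : node -> Prop) t :
  (forall s, p s -> q s) -> wide n p t -> wide n q t.
Proof. by move=> pq [K [? ? Kp]]; exists K; split=> // i /Kp/pq. Qed.

Lemma wide_split n (p : node -> Prop) t : wide n p t ->
  exists i j, [/\ i <> j, p (i :: t) & p (j :: t)].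
Proof.
move=> [[|i [|j K]] [Ku Ks Kp]] //.
  by move: Ks; rewrite ltnS leqn0 expn_eq0 -leqn0 leqNgt (ltn_trans _ (bound_gt1 _)).
exists i, j; split; try by apply: Kp; rewrite !inE eqxx ?orbT.
by move=> ij; move: Ku; rewrite /= ij inE eqxx.
Qed.

Lemma wide_mem n p t : wide n p t -> p t.
Proof.
move=> /wide_split[i [_ [_ pit _]]]; apply: tree_suffix pit.
exact: suffix_cons.
Qed.

(** A node has at most one more child than the [index_of t]-th power of its
    slack, so large norm forces large index. *)
Lemma wide_index n p t : wide n p t -> n <= index_of t.
Proof.
move=> [K [Ku Ks Kp]].
have : size K <= size (iota 0 (arity t)).
  by apply: uniq_leq_size => // i /Kp/tree_arity; rewrite mem_iota.
rewrite size_iota => /(leq_trans Ks); rewrite ltnS.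
by rewrite leq_exp2l // bound_gt1.
Qed.

Lemma tree_long p n : exists2 t, p t & n <= size t.
Proof.
elim: n => [|n [t pt nt]]; first by exists [::] => //; apply: tree_root.
have [u tu /wide_split[i [_ [_ pu _]]]] := tree_wide 0 pt.
by exists (i :: u) => //; apply: leq_trans nt (size_suffix tu).
Qed.

(** Trees have arbitrarily long nodes, and a long node compatible with u extends u. *)
Lemma compatible_mem p u : (forall t, p t -> compatible u t) -> p u.
Proof.
move=> h; have [t pt ut] := tree_long p (size u).
have /orP[/tree_suffix|tu] := h t pt; first exact.
suff -> : u = t by [].
have [w uE] := suffixP tu; move: ut; rewrite uE size_cat -{2}(add0n (size t)).
by rewrite leq_add2r; case: w {uE}.
Qed.

Lemma wide_suffix n p u s :
  (forall t, p t -> compatible u t) -> wide n p s -> suffix u s.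
Proof.
move=> h ws; have /orP[//|su] := h s (wide_mem ws).
have [<-|/eqP su'] := eqVneq s u; first exact: suffix_refl.
have [i [j [ij pi pj]]] := wide_split ws; case: ij.
have c k : p (k :: s) -> compatible (k :: s) u by move=> /h; rewrite compatible_sym.
exact: compatible_children (c _ pi) (c _ pj) su su'.
Qed.

Fact through_subproof p s : p s -> is_tree (fun t => p t /\ compatible s t).
Proof.
move=> ps; split.
- by split; [exact: tree_root|rewrite /compatible suffix0s orbT].
- move=> i t [pit c]; split; last exact: tree_arity pit.
  split; first by apply: tree_suffix pit; apply: suffix_cons.
  case/orP: c => [|its]; last first.
    by rewrite /compatible (suffix_trans (suffix_cons t i) its) orbT.
  rewrite /compatible suffix_consE => /predU1P[->|->//].
  by rewrite suffix_cons orbT.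
- move=> n t [pt c].
  have [u [tu su pu]] : exists u, [/\ suffix t u, suffix s u & p u].
    by case/orP: c => ?; [exists t|exists s]; split=> //; apply: suffix_refl.
  have [v uv [K [Ku Ks Kp]]] := tree_wide n pu.
  exists v; first exact: suffix_trans uv.
  exists K; split=> // i /Kp pi; split=> //.
  by rewrite /compatible suffix_consE (suffix_trans su uv) orbT.
Qed.

(** The part of p compatible with s.  The default p when s is not in p keeps the
    operation total. *)
Definition through p s : tree :=
  if pselect (p s) is left ps then Tree (through_subproof ps) else p.

Lemma throughP p s t : p s -> through p s t <-> p t /\ compatible s t.
Proof. by rewrite /through; case: pselect. Qed.

Lemma through_stronger p s : through p s ≼ p.
Proof. by rewrite /through; case: pselect => [ps t []|_ t]. Qed.

Lemma through_le p q s : q ≼ p -> q s -> through q s ≼ through p s.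
Proof.
move=> qp qs t /(throughP _ qs)[qt st]; apply/throughP; first exact: qp.
by split=> //; apply: qp.
Qed.

Definition stem n p s := wide n p s /\ forall t, p t -> compatible s t.

(** Shrink p above the children of s listed in K independently of each other and
    drop the other children; the result still has norm n at s. *)
Lemma amalgam p n s (K : seq nat) (g : nat -> tree) :
  uniq K -> slack s ^ n < size K ->
  (forall i, i \in K -> p (i :: s) /\ g i ≼ through p (i :: s)) ->
  exists r, [/\ r ≼ p, stem n r s, forall i, r (i :: s) -> i \in K &
    forall i, i \in K -> through r (i :: s) ≼ g i].
Proof.
move=> Ku Ks h.
have gc i t : i \in K -> g i t -> compatible (i :: s) t.
  by move=> iK git; have [pi gi] := h i iK; have [] := (throughP t pi).1 (gi t git).
have gi i : i \in K -> g i (i :: s).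
  by move=> iK; apply: compatible_mem => t; apply: gc.
have gp i : i \in K -> g i ≼ p.
  move=> iK; apply: stronger_trans (@through_stronger p (i :: s)).
  by have [] := h i iK.
have rtree : is_tree (fun t => exists2 i, i \in K & g i t).
  split.
  - case: K Ks {Ku h gc gi gp} => // i K _.
    by exists i; [rewrite inE eqxx|apply: tree_root].
  - move=> j t [i iK git]; split; last exact: tree_arity git.
    by exists i => //; apply: tree_suffix git; apply: suffix_cons.
  - move=> m t [i iK /(tree_wide m)[u tu wu]]; exists u => //.
    by apply: wide_sub wu => v; exists i.
have eqK i j : i \in K -> g i (j :: s) -> j = i.
  move=> iK /(gc _ _ iK); rewrite /compatible !suffix_consE.
  move=> /orP[]/predU1P[[]//|/size_suffix]; by rewrite /= ltnn.
exists (Tree rtree); split.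
- by move=> t [i iK]; apply: gp.
- split; first by exists K; split=> // i iK; exists i => //; apply: gi.
  move=> t [i iK /(gc _ _ iK)/orP[ist|]].
    by rewrite /compatible (suffix_trans (suffix_cons s i) ist).
  rewrite suffix_consE => /predU1P[->|ts]; rewrite /compatible ?suffix_cons//.
  by rewrite ts orbT.
- by move=> j [i iK /eqK->].
- move=> i iK t /throughP[|[j jK gjt] c]; first by exists i => //; apply: gi.
  have [<-//|ji] := eqVneq j i.
  have ts : suffix t s.
    apply: contrapT => nts; case/eqP: ji.
    apply: (compatible_children (s := s) (t := t)) => //.
    + exact: gc.
    + have /orP[jst|] := gc _ _ jK gjt.
        exact: suffix_trans (suffix_cons s j) jst.
      by rewrite suffix_consE => /predU1P[->|//]; apply: suffix_cons.
    + by move=> st; apply: nts; rewrite st suffix_refl.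
  by apply: tree_suffix (gi _ iK); rewrite suffix_consE ts orbT.
Qed.

Fixpoint in_range s : bool := if s is i :: t then (i < arity t) && in_range t else true.

(** Infinitely many nodes extend s, so one of them has index at least n, and the
    full set of its children then has norm n. *)
Fact full_subproof : is_tree in_range.
Proof.
split=> // [i s /= /andP[]//|n s rs].
have [m mn] : exists m, n <= index_of (nseq m 0 ++ s).
  apply: contrapT => h.
  have inj : injective (fun m => index_of (nseq m 0 ++ s)).
    by move=> a b /(pcan_inj pickleK)/(congr1 size); rewrite !size_cat !size_nseq => /addIn.
  have : size (map (fun m => index_of (nseq m 0 ++ s)) (iota 0 n.+1)) <= size (iota 0 n).
    apply: uniq_leq_size; first by rewrite map_inj_uniq ?iota_uniq.
    move=> x /mapP[m _ ->]; rewrite mem_iota /= add0n ltnNge.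
    by apply/negP => H; apply: h; exists m.
  by rewrite size_map !size_iota ltnn.
exists (nseq m 0 ++ s); first exact: suffix_suffix.
exists (iota 0 (arity (nseq m 0 ++ s))); split.
- exact: iota_uniq.
- by rewrite size_iota ltnS leq_exp2l // bound_gt1.
- move=> i; rewrite mem_iota /= => ->.
  by elim: {mn} m => //= m ->.
Qed.
Definition full := Tree full_subproof.

(** * Fusion *)

Section Fusion.
Context (commit : nat -> tree -> tree * node).
Context (Q : nat -> tree -> node -> Prop).
Context (commit_le : forall n r, (commit n r).1 ≼ r).
Context (commit_stem : forall n r, stem n (commit n r).1 (commit n r).2).
Context (commitQ : forall n r, Q n (commit n r).1 (commit n r).2).
Context (p : tree).

(** The fusion is read along a branch: the state at t records how many tips have
    been passed, the tree currently promised, and its tip, which is the next node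
    where the fused tree splits.  Past the tip, the promised tree is cut down to
    the chosen child and [commit] shrinks it at the next level.  This yields the
    fused tree in one recursion on nodes instead of as the intersection of a
    decreasing sequence of trees. *)
Fixpoint fusion_state t : nat * (tree * node) :=
  if t is i :: t' then
    let x := fusion_state t' in
    if t' == x.2.2 then (x.1.+1, commit x.1.+1 (through x.2.1 t)) else x
  else (0, commit 0 p).

Local Notation lev t := (fusion_state t).1.
Local Notation cur t := (fusion_state t).2.1.
Local Notation tip t := (fusion_state t).2.2.

Fixpoint fusion_set t : Prop :=
  if t is i :: t' then fusion_set t' /\ cur t' t else True.

Lemma fusion_commit t : exists r, fusion_state t = (lev t, commit (lev t) r).
Proof.
elim: t => [|i t [r IH]] /=; first by exists p.
by case: ifP => _ /=; [exists (through (cur t) (i :: t))|exists r].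
Qed.

Lemma fusion_stem t : stem (lev t) (cur t) (tip t).
Proof. by have [r ->] := fusion_commit t; apply: commit_stem. Qed.

Lemma fusion_prop t : Q (lev t) (cur t) (tip t).
Proof. by have [r ->] := fusion_commit t; apply: commitQ. Qed.

Lemma fusion_tip t : cur t (tip t).
Proof. by have [w _] := fusion_stem t; apply: wide_mem w. Qed.

(** When the state changes at [i :: t], the new promised tree consists of nodes
    compatible with [i :: t] and splits at its tip, so the tip is above. *)
Lemma fusion_inv t : fusion_set t -> cur t t /\ suffix t (tip t).
Proof.
elim: t => [_|i t IH [/IH[tt ttip] it]].
  by split; [apply: tree_root|apply: suffix0s].
have [_ tipc] := fusion_stem t.
rewrite /=; case: ifPn => [/eqP tE|tn] /=; last first.
  split=> //; have /orP[] := tipc _ it; last by [].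
  rewrite suffix_consE => /predU1P[->|tipt]; first exact: suffix_refl.
  by case/eqP: tn; apply: suffix_antisym.
set r := commit _ _.
have rc u : r.1 u -> compatible (i :: t) u.
  by move=> /commit_le/throughP[|].
split; first exact: compatible_mem.
exact: wide_suffix rc (proj1 (commit_stem _ _)).
Qed.

Lemma fusion_mono t u : suffix t u -> fusion_set u -> cur u ≼ cur t.
Proof.
move=> /suffixP[w ->]; elim: w => [_ v|i w IH [/IH le _]] //.
apply: (stronger_trans _ le) => /=; case: ifP => _ /=; last by move=> v.
by move=> v rv; apply: through_stronger (commit_le rv).
Qed.

(** Between t and the current tip nothing is cut and the state does not change. *)
Lemma fusion_climb t u : fusion_set t -> suffix t u -> suffix u (tip t) ->
  fusion_set u /\ fusion_state u = fusion_state t.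
Proof.
move=> ft /suffixP[w ->]; elim: w => //= i w IH iw.
have wtip : suffix (w ++ t) (tip t) := suffix_trans (suffix_cons _ i) iw.
have [fw sw] := IH wtip; rewrite sw; split.
  by split=> //; apply: tree_suffix iw (fusion_tip t).
case: eqP => // wE; move: iw; rewrite wE => /size_suffix.
by rewrite /= ltnn.
Qed.

Lemma fusion_unbounded t n : fusion_set t ->
  exists u, [/\ suffix t u, fusion_set u, tip u = u & n <= lev u].
Proof.
move=> ft.
have top s : fusion_set s -> exists u,
    [/\ suffix s u, fusion_set u, tip u = u & lev u = lev s].
  move=> fs; have [_ stip] := fusion_inv fs.
  have [fu su] := fusion_climb fs stip (suffix_refl _).
  by exists (tip s); rewrite su; split.
elim: n => [|n [u [tu fu uE nu]]].
  by have [u [? ? ? _]] := top t ft; exists u.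
have [/wide_split[i [_ [_ ui _]]] _] := fusion_stem u.
rewrite uE in ui.
have [v [uv fv vE lv]] := top (i :: u) (conj fu ui).
exists v; split=> //; last by rewrite lv /= uE eqxx.
exact: suffix_trans tu (suffix_trans (suffix_cons _ i) uv).
Qed.

Fact fusion_subproof : is_tree fusion_set.
Proof.
split=> // [i s /= [fs /tree_arity]//|n s fs].
have [u [su fu uE nu]] := fusion_unbounded n fs.
exists u => //; apply: wide_le nu _.
have [[K [Ku Ks Kp]] _] := fusion_stem u; rewrite uE in Ks Kp.
by exists K; split=> // i /Kp ?; split.
Qed.
Definition fusion_tree := Tree fusion_subproof.

Lemma fusion_cur_le t : fusion_tree t -> cur t ≼ p.
Proof.
by move=> ft u /(fusion_mono (suffix0s t) ft)/commit_le.
Qed.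

Lemma fusion_tree_le : fusion_tree ≼ p.
Proof. by move=> t ft; apply: (fusion_cur_le ft); have [] := fusion_inv ft. Qed.

Lemma fusion_through t : fusion_tree t -> through fusion_tree t ≼ cur t.
Proof.
move=> ft u /(throughP _ ft)[fu /orP[tu|ut]].
  by apply: (fusion_mono tu fu); have [] := fusion_inv fu.
by apply: tree_suffix ut _; have [] := fusion_inv ft.
Qed.

End Fusion.

(** If every tree r can be shrunk, for every n, to a tree with a stem of norm n and
    property Q, then p can be shrunk to a tree p' which above each node t lies in
    such a tree R t, with stem S t and norm L t, and which splits only at these
    tips.  The level L grows by one at each tip. *)
Lemma fusion (Q : nat -> tree -> node -> Prop) (p : tree) :
  (forall n r, exists r' s, [/\ r' ≼ r, stem n r' s & Q n r' s]) ->
  exists (p' : tree) (L : node -> nat) (R : node -> tree) (S : node -> node),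
  [/\ p' ≼ p,
      forall t, p' t ->
        [/\ Q (L t) (R t) (S t), through p' t ≼ R t, R t ≼ p &
            stem (L t) (R t) (S t)],
      forall i t, p' (i :: t) -> t <> S t ->
        L (i :: t) = L t /\ S (i :: t) = S t,
      forall i t, p' (i :: t) -> t = S t -> L (i :: t) = (L t).+1 &
      forall i j t, p' (i :: t) -> p' (j :: t) -> i <> j -> S t = t].
Proof.
move=> h.
have /choice[f hf] (x : nat * tree) : exists y : tree * node,
    [/\ y.1 ≼ x.2, stem x.1 y.1 y.2 & Q x.1 y.1 y.2].
  by have [r' [s H]] := h x.1 x.2; exists (r', s).
pose commit n r := f (n, r).
have cle n r : (commit n r).1 ≼ r by have [] := hf (n, r).
have cst n r : stem n (commit n r).1 (commit n r).2 by have [] := hf (n, r).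
have cQ n r : Q n (commit n r).1 (commit n r).2 by have [] := hf (n, r).
pose st := fusion_state commit p.
exists (fusion_tree cle cst p), (fun t => (st t).1), (fun t => (st t).2.1),
  (fun t => (st t).2.2); split.
- exact: fusion_tree_le.
- move=> t pt; split.
  + exact: (fusion_prop cQ).
  + exact: fusion_through.
  + exact: fusion_cur_le.
  + exact: (fusion_stem cst).
- by move=> i t _ /eqP/negbTE tn; rewrite /st /= tn.
- by move=> i t _ /eqP tE; rewrite /st /= tE.
- move=> i j t [ft iR] [_ jR] ij; apply: contrapT => tn.
  have [_ ttip] := fusion_inv cle cst ft.
  have [_ tipc] := fusion_stem cst p t.
  case: ij; apply: compatible_children ttip _.
  + by rewrite compatible_sym; apply: tipc.
  + by rewrite compatible_sym; apply: tipc.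
  + by move=> /esym.
Qed.

(** * Separating trees and bounding trees *)

Lemma through_child p r i t : through p t ≼ r -> p (i :: t) ->
  r (i :: t) /\ through p (i :: t) ≼ through r (i :: t).
Proof.
move=> pr pi.
have pt : p t := tree_suffix (suffix_cons t i) pi.
have sub u : p u -> compatible (i :: t) u -> r u.
  move=> pu c; apply: pr; apply/throughP => //; split=> //.
  case/orP: c => [/(suffix_trans (suffix_cons t i))|]; rewrite /compatible.
    by move=> ->.
  by rewrite suffix_consE => /predU1P[->|->]; rewrite ?suffix_cons ?orbT.
have ri : r (i :: t) by apply: sub pi _; rewrite /compatible suffix_refl.
split=> // u /(throughP _ pi)[pu c]; apply/throughP => //; split=> //.
exact: sub.
Qed.

Section Separating.
Context (A : set (regopen tree_forcing)).
Context (cA : complete_subalgebra A) (atA : atomless A).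
Local Notation separated := (@separated tree_forcing A).

Lemma separate_one i (K : seq nat) (g : nat -> tree) : i \notin K ->
  exists g' : nat -> tree, (forall j, g' j ≼ g j) /\
    forall j, j \in K -> separated (g' i) (g' j).
Proof.
elim: K => [_|j K IH]; first by exists g; split=> // j; apply: stronger_refl.
rewrite inE negb_or => /andP[ij /IH[g1 [g1g g1K]]].
have [p [q [pi qj pq]]] := separated_dense cA (g1 i) (g1 j) atA.
exists (fun k => if k == i then p else if k == j then q else g1 k).
have le k : (if k == i then p else if k == j then q else g1 k) ≼ g1 k.
  case: eqP => [->//|_]; case: eqP => [->//|_]; exact: stronger_refl.
split=> [k|k]; first exact: stronger_trans (le k) (g1g k).
rewrite eqxx inE => /predU1P[->|kK]; first by rewrite eq_sym (negbTE ij) eqxx.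
exact: separated_down (le k) (g1K _ kK).
Qed.

(** Finitely many conditions have finitely many pairs, and separation persists
    under strengthening. *)
Lemma separate_all (K : seq nat) (g : nat -> tree) : uniq K ->
  exists g' : nat -> tree, (forall j, g' j ≼ g j) /\
    forall i j, i \in K -> j \in K -> i <> j -> separated (g' i) (g' j).
Proof.
elim: K => [_|i K IH /= /andP[iK /IH[g1 [g1g g1K]]]].
  by exists g; split=> // j; apply: stronger_refl.
have [g2 [g21 g2K]] := separate_one g1 iK.
exists g2; split=> [j|j k]; first exact: stronger_trans (g21 j) (g1g j).
rewrite !inE => /predU1P[->|jK] /predU1P[->|kK] // jk.
- exact: g2K.
- exact/(separated_sym cA)/g2K.
- exact: separated_down (g21 j) (g21 k) (g1K _ _ jK kK jk).
Qed.

(** Minimality: the generic filter of A determines the branch through q', because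
    at each splitting node it tells the children apart. *)
Lemma separating_tree q : exists2 q' : tree, q' ≼ q &
  forall t i j, q' (i :: t) -> q' (j :: t) -> i <> j ->
    separated (through q' (i :: t)) (through q' (j :: t)).
Proof.
pose Q (n : nat) r s := forall i j, r (i :: s) -> r (j :: s) -> i <> j ->
  separated (through r (i :: s)) (through r (j :: s)).
have [n r|q' [L [R [S [q'q qR _ _ qS]]]]] := @fusion Q q.
  have [s _ [K [Ku Ks Kp]]] := tree_wide n (tree_root r).
  have [g [gr gK]] := separate_all (fun i => through r (i :: s)) Ku.
  have [|r' [r'r st rK rg]] := @amalgam r n s K g Ku Ks.
    by move=> i iK; split; [apply: Kp|apply: gr].
  exists r', s; split=> // i j /rK iK /rK jK ij.
  exact: separated_down (rg i iK) (rg j jK) (gK i j iK jK ij).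
exists q' => // t i j ti tj ij; have tt := tree_suffix (suffix_cons t i) ti.
have [+ qRt _ _] := qR t tt; rewrite (qS _ _ _ ti tj ij).
have [Ri qi] := through_child qRt ti; have [Rj qj] := through_child qRt tj.
by move=> /(_ i j Ri Rj ij); apply: separated_down.
Qed.

End Separating.

Lemma pigeonhole (K : seq nat) (f : nat -> nat) M X : uniq K ->
  (forall i, i \in K -> f i < M) -> X * M < size K ->
  exists K' c, [/\ uniq K', {subset K' <= K}, X < size K' &
    forall i, i \in K' -> f i = c].
Proof.
elim: M K => [[]//= i K _ /(_ i)|M IH K Ku fM KX].
  by rewrite inE eqxx => /(_ isT).
have [cX|cX] := ltnP X (count (fun i => f i == M) K).
  exists [seq i <- K | f i == M], M.
  split=> [|i||i]; rewrite ?filter_uniq ?size_filter //.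
    by rewrite mem_filter => /andP[].
  by rewrite mem_filter => /andP[/eqP].
have [|||K' [c [K'u K'K XK' K'c]]] := IH [seq i <- K | f i != M].
- exact: filter_uniq.
- move=> i; rewrite mem_filter => /andP[fi /fM].
  by rewrite ltnS leq_eqVlt (negbTE fi).
- rewrite size_filter -(ltn_add2l (count (fun i => f i == M) K)).
  rewrite (count_predC (fun i => f i == M)); apply: leq_ltn_trans KX.
  by rewrite mulnS leq_add2r.
exists K', c; split=> // i /K'K.
by rewrite mem_filter => /andP[].
Qed.

(** Applying the pigeonhole principle once for each of the j colourings divides
    the size by the product of their ranges, which [bound j] exceeds. *)
Lemma homogeneous (col : nat -> nat -> nat) j X (K : seq nat) :
  (forall i k, i \in K -> k < j -> col i k < width k) ->
  uniq K -> X * bound j < size K ->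
  exists K', [/\ uniq K', {subset K' <= K}, X < size K' &
    forall k, k < j -> exists c, forall i, i \in K' -> col i k = c].
Proof.
elim: j X => [|j IH] X colK Ku KX.
  by exists K; split=> //; apply: leq_ltn_trans KX; rewrite leq_pmulr.
have [||K1 [K1u K1K K1X K1c]] := IH (X * width j) _ Ku.
- by move=> i k iK kj; apply: colK => //; apply: ltnW.
- apply: leq_ltn_trans KX; rewrite /= -/(width j) -mulnA leq_mul2l mulnC.
  by rewrite leq_mul2l leqnSn !orbT.
have [|K' [c [K'u K'K K'X K'c]]] := pigeonhole (f := col^~ j) K1u _ K1X.
  by move=> i /K1K iK; apply: colK.
exists K'; split=> // [i /K'K/K1K//|k]; rewrite ltnS leq_eqVlt.
case/predU1P => [->|/K1c[d K1d]]; first by exists c.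
by exists d => i /K'K/K1d.
Qed.

(** The list collects the root and the children of the nodes of index below k.
    A front of a tree that splits only at such nodes before the front is matched
    by a part of it: replace each node of the front by the last child of a
    splitting node on the way to it. *)
Lemma front_list k : exists l : seq node,
  [/\ [::] \in l, size l <= bound k &
    forall s i, index_of s < k -> i < arity s -> i :: s \in l].
Proof.
elim: k => [|k [l [l0 lk lP]]]; first by exists [:: [::]].
have [[s sk]|ns] := pselect (exists s, index_of s = k); last first.
  exists l; split=> // [|s i]; first by apply: leq_trans lk _; rewrite /= leq_pmulr.
  rewrite ltnS leq_eqVlt => /predU1P[sk|]; last exact: lP.
  by case: ns; exists s.
exists (l ++ [seq i :: s | i <- iota 0 (width k)]); split.
- by rewrite mem_cat l0.
- rewrite size_cat size_map size_iota /= -/(width k) mulnS leq_add // leq_pmull //.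
  exact: ltnW (bound_gt1 k).
- move=> t i; rewrite mem_cat ltnS leq_eqVlt => /predU1P[tk|tk] it; last by rewrite lP.
  have -> : t = s by apply: (pcan_inj pickleK); rewrite -/(index_of t) tk -sk.
  apply/orP; right; apply/mapP; exists i => //.
  by rewrite mem_iota /= -tk.
Qed.

(** [dec r k c] stands for: r forces the k-th of a sequence of names for natural
    numbers to have value c. *)
Section Bounding.
Context (dec : tree -> nat -> nat -> Prop).
Context (dec_down : forall r r' k c, r' ≼ r -> dec r k c -> dec r' k c).
Context (dec_dense : forall r k,
  exists r' c, [/\ r' ≼ r, c < width k & dec r' k c]).

Lemma decide_below r j : exists r' (col : nat -> nat), r' ≼ r /\
  forall k, k < j -> col k < width k /\ dec r' k (col k).
Proof.
elim: j => [|j [r1 [col [r1r colP]]]].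
  by exists r, (fun=> 0); split=> //; apply: stronger_refl.
have [r2 [c [r21 cj dc]]] := dec_dense r1 j.
exists r2, (fun k => if k == j then c else col k); split.
  exact: stronger_trans r21 r1r.
move=> k; rewrite ltnS leq_eqVlt; case: eqP => [->//|_ /= /colP[cw dk]].
by split=> //; apply: dec_down dk.
Qed.

(** Each tip s is made to decide all names of index below the index of s: below
    each child of s decide them, then keep children with equal decisions, which
    costs one unit of norm as there are at most [slack s] possible decisions.  If
    k is the index of no splitting node of p, the k-th name is therefore decided
    at the first node of a branch whose tip has index above k.  Such a node is in
    [front_list k], so at most [bound k] values remain possible. *)
Lemma bounding p : exists (p' : tree) (C : nat -> seq nat), p' ≼ p /\
  forall k, size (C k) <= bound k /\
    ((forall t i j, index_of t = k -> p (i :: t) -> p (j :: t) -> i = j) ->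
     forall r, r ≼ p' -> exists r' c, [/\ r' ≼ r, c \in C k & dec r' k c]).
Proof.
pose Q (n : nat) r s := forall k, k < index_of s -> exists c,
  forall r1, r1 ≼ r -> exists2 r2 : tree, r2 ≼ r1 & dec r2 k c.
have [n r|p' [L [R [S [p'p pR pn pL pS]]]]] := @fusion Q p.
  have [s _ [K [Ku Ks Kp]]] := tree_wide n.+1 (tree_root r).
  have /choice[g /choice[col gcol]] (i : nat) :=
    decide_below (through r (i :: s)) (index_of s).
  have [| |K' [K'u K'K K's K'c]] := homogeneous (col := col) (j := index_of s)
      (X := slack s ^ n) _ Ku.
  - by move=> i k _ /(proj2 (gcol i))[].
  - by move: Ks; rewrite expnSr.
  have [|r' [r'r st rK rg]] := @amalgam r n s K' g K'u K's.
    by move=> i /K'K/Kp ri; split=> //; have [] := gcol i.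
  exists r', s; split=> // k ks; have [c cK] := K'c k ks.
  exists c => r1 r1r'.
  have [t r1t tsz] := tree_long r1 (size s).+1.
  have /orP[st'|/size_suffix ts] := (proj2 st) t (r1r' t r1t); last first.
    by have := leq_trans tsz ts; rewrite ltnn.
  have nst : s <> t by move=> stE; move: tsz; rewrite stE ltnn.
  have [i ist] := suffix_child st' nst.
  have r1i : r1 (i :: s) := tree_suffix ist r1t.
  have iK := rK i (r1r' _ r1i).
  exists (through r1 (i :: s)); first exact: through_stronger.
  apply: (@dec_down (g i)).
    exact: stronger_trans (through_le r1r' r1i) (rg i iK).
  by rewrite -(cK i iK); have [] := proj2 (gcol i) k ks.
have Cex (x : node * nat) : exists c, p' x.1 -> x.2 < index_of (S x.1) ->
    forall r1, r1 ≼ R x.1 -> exists2 r2 : tree, r2 ≼ r1 & dec r2 x.2 c.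
  have [[xp xk]|n] := pselect (p' x.1 /\ x.2 < index_of (S x.1)); last first.
    by exists 0 => xp xk; case: n.
  by have [/(_ _ xk)[c H] _ _ _] := pR _ xp; exists c.
have [c cP] := choice Cex.
have [l lP] := choice front_list.
exists p', (fun k => [seq c (t, k) | t <- l k]); split=> // k.
have [lk0 lks lkP] := lP k; split=> [|pk r rp']; first by rewrite size_map.
have Lmono t i : p' (i :: t) -> L t <= L (i :: t).
  move=> pi; have [e|/eqP e] := eqVneq t (S t); first by rewrite pL.
  by have [-> _] := pn _ _ pi e.
have Lmono' t u : suffix t u -> p' u -> L t <= L u.
  move=> /suffixP[w ->]; elim: w => //= i w IH pi.
  by apply: leq_trans (Lmono _ _ pi); apply: IH; apply: tree_suffix pi; apply: suffix_cons.
(* Levels grow along r because splitting nodes of r split p' and hence are tips. *)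
have [t rt kt] : exists2 t, r t & k.+1 <= L t.
  elim: k.+1 => [|n [t rt nt]]; first by exists [::] => //; apply: tree_root.
  have [u tu /wide_split[i [j [ij ri rj]]]] := tree_wide 0 rt.
  have ru := tree_suffix (suffix_cons u i) ri.
  have Su := pS _ _ _ (rp' _ ri) (rp' _ rj) ij.
  exists (i :: u) => //; rewrite (pL _ _ (rp' _ ri)) // ltnS.
  by apply: leq_trans nt _; apply: Lmono' => //; apply: rp'.
have {kt} kt : k < index_of (S t).
  have [_ _ _ [/wide_index H _]] := pR t (rp' _ rt).
  exact: leq_trans H.
have [t0 [t0l t0t kt0]] : exists t0, [/\ t0 \in l k, suffix t0 t & k < index_of (S t0)].
  move: (rp' _ rt) kt; elim: (t) => [_ H|i u IH pi].
    by exists [::]; split=> //; rewrite suffix0s.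
  have pu := tree_suffix (suffix_cons u i) pi.
  have up t0 : suffix t0 u -> suffix t0 (i :: u).
    by move=> H; apply: suffix_trans H (suffix_cons _ _).
  have [uS|/eqP nuS] := eqVneq u (S u); last first.
    have [_ ->] := pn _ _ pi nuS; move=> /(IH pu)[t0 [? ? ?]].
    by exists t0; split=> //; apply: up.
  move=> kS; have [uk|ku|ku] := ltngtP (index_of u) k.
  - exists (i :: u); split=> //; last exact: suffix_refl.
    by apply: lkP => //; apply: tree_arity pi.
  - have := IH pu; rewrite -uS => /(_ ku)[t0 [? ? ?]].
    by exists t0; split=> //; apply: up.
  - have [_ _ Rp [/wide_split[a [b [ab Ra Rb]]] _]] := pR _ pu.
    rewrite -uS in Ra Rb; case: ab.
    by apply: (pk u) => //; apply: Rp.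
have rt0 := tree_suffix t0t rt.
have [_ Rt0 _ _] := pR t0 (rp' _ rt0).
have [|r2 r2r d] := cP (t0, k) (rp' _ rt0) kt0 (through r t0).
  exact: stronger_trans (through_le rp' rt0) Rt0.
exists r2, (c (t0, k)); split=> //.
  exact: stronger_trans r2r (@through_stronger _ _).
by apply/mapP; exists t0.
Qed.

End Bounding.

(** * The regular open algebra of the forcing with trees *)

Lemma through_hit p t r : p t -> r ≼ through p t -> r t.
Proof. by move=> pt rp; apply: compatible_mem => u /rp/(throughP _ pt)[]. Qed.

Fact cone_subproof u :
  @regular_open tree_forcing [set p | forall t, tree_set p t -> compatible u t].
Proof.
move=> p; split=> [h q qp|h t pt].
  by exists q; [exact: stronger_refl|move=> t /qp/h].
have [r rp rc] := h _ (@through_stronger p t).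
by apply: rc; apply: through_hit rp.
Qed.
(** The generic branch passes through u. *)
Definition cone u := RegOpen (cone_subproof u).

Lemma notin_cone p u : p u -> ~ (~` cone u)%O p.
Proof.
move=> pu /ro_complP/(_ _ (@through_stronger p u)); apply=> t.
by move=> /(throughP _ pu)[].
Qed.

Lemma hull_tree p q : hull p q -> q ≼ p.
Proof.
move=> h s qs; have [r rq rp] := h _ (@through_stronger q s).
exact/rp/(through_hit qs).
Qed.

(** A tree is the meet of the complements of the cones over the nodes it misses,
    and every element of the algebra is the join of the trees below it. *)
Lemma cones_generate (C : set (regopen tree_forcing)) :
  complete_subalgebra C -> (forall u, C (cone u)) -> C = setT.
Proof.
move=> cC Ccone; apply/seteqP; split=> // x _.
have Chull p : C (hull p).
  pose N := [set a | exists2 s, ~ p s & a = (~` cone s)%O].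
  have NC : N `<=` C by move=> _ [s _ ->]; apply: subalgebra_compl.
  apply: (proj2 (proj2 cC N NC)); split.
    move=> _ [s nps ->]; apply/hull_leP/ro_complP => q qp qs.
    by apply: nps; apply: qp; apply: compatible_mem qs.
  move=> a aN; apply/ro_leP => q aq; apply: (regopen_down _ (@hullxx _ p)) => s qs.
  apply: contrapT => nps; apply: (notin_cone qs).
  by have /ro_leP : (a <= ~` cone s)%O; [apply: aN; exists s|apply].
pose H := [set a | exists2 p, regopen_set x p & a = hull p].
have HC : H `<=` C by move=> _ [p _ ->].
apply: (proj1 (proj2 cC H HC)); split.
  by move=> _ [p xp ->]; apply/hull_leP.
move=> a aH; apply/ro_leP => p xp; apply/hull_leP.
by apply: aH; exists p.
Qed.

Lemma trees_generated : countably_generated (regopen tree_forcing).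
Proof.
exists (range cone); first exact: sub_countable (card_image_le _ _) (countableP _).
apply/seteqP; split=> // x _ C [cC coneC].
rewrite (cones_generate cC) // => u; apply: coneC.
by exists u.
Qed.

Lemma trees_atomless : atomless [set: regopen tree_forcing].
Proof.
move=> a [_ abot amin].
have [p ap] : exists p, regopen_set a p.
  apply: contrapT => na; apply: abot; apply: regopen_ext => p; split=> // ap.
  by case: na; exists p.
have [s _ /wide_split[i [j [ij pi pj]]]] := tree_wide 0 (tree_root p).
have sub k : regopen_set a (through p (k :: s)).
  exact: regopen_down (@through_stronger p _) ap.
have [|hb|ha] := amin (hull (through p (i :: s))) I.
- exact/hull_leP.
- by have := @hullxx _ (through p (i :: s)); rewrite hb.
- have := sub j; rewrite -ha => /hull_tree h.
  have /h/(throughP _ pi)[_] : through p (j :: s) (j :: s).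
    by apply/throughP; rewrite // /compatible suffix_refl.
  rewrite /compatible !suffix_consE => /orP[]/predU1P[[]//|/size_suffix];
    by [move=> /esym|rewrite /= ltnn].
Qed.

(** If A missed cone u, the least element al of A above it would meet the
    complement of the cone, say in q0.  A separating tree q below q0 makes the
    branch through q readable from A.  As q forces al, its envelope c in A is
    forced by some p inside the cone.  Below p, let the k-th name be the child of
    the node of index k on the branch through q.  A tree p' bounding these names
    allows at most [bound k] children of each node of q of index k, so norm less
    than 1; but a condition q' below q that forces the envelope of p' has a node
    of norm 1, and A links every part of q' to a condition below p'. *)
Lemma trees_simple (A : set (regopen tree_forcing)) :
  complete_subalgebra A -> atomless A -> A = setT.
Proof.
move=> cA atA; apply: cones_generate => // u.
apply: contrapT => nAu.
have [al [Aal ual almin]] :=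
  complete_subalgebra_envelope (cone u) (@regopen_complete _) cA.
have [q0 alq0 uq0] : exists2 q0, regopen_set al q0 & (~` cone u)%O q0.
  apply: contrapT => h; apply: nAu.
  suff -> : cone u = al by [].
  apply/le_anti; rewrite ual /=; apply/ro_leP => p alp.
  apply: contrapT => /not_in_regopen[q qp uq]; apply: h; exists q => //.
  exact: regopen_down alp.
have [q qq0 qsep] := separating_tree cA atA q0.
have [c [Ac cq cmin]] := envelope cA q.
have [p pu pc] : exists2 p, regopen_set (cone u) p & regopen_set c p.
  apply: contrapT => h.
  have alc : (al <= ~` c)%O.
    apply: almin; first exact: subalgebra_compl.
    apply/ro_leP => p pu; apply/ro_complP => p' p'p cp'; apply: h.
    by exists p' => //; apply: regopen_down pu.
  apply: (regopen_compl_absurd cq); move/ro_leP: alc; apply.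
  exact: regopen_down alq0.
(* The name for the child taken at the node of index k by the branch through q. *)
pose dec r k e := forall t, index_of t = k -> forall i, q (i :: t) -> i <> e ->
  separated A r (through q (i :: t)).
have dec_down r r' k e : r' ≼ r -> dec r k e -> dec r' k e.
  move=> r'r d t tk i qi ie; apply: separated_down r'r _ (d t tk i qi ie).
  exact: stronger_refl.
have dec_dense r k : exists r' e, [/\ r' ≼ r, e < width k & dec r' k e].
  have [[t tk]|nk] := pselect (exists t, index_of t = k); last first.
    exists r, 0; split=> //.
    by move=> t tk; case: nk; exists t.
  have tu t' : index_of t' = k -> t' = t.
    by rewrite -tk; apply: (pcan_inj pickleK).
  have [[i [r' [qi r'r ir']]]|ni] := pselect (exists i r', [/\ q (i :: t), r' ≼ r &
      forall a, A a -> regopen_set a (through q (i :: t)) -> regopen_set a r']).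
    exists r', i; split=> //; first by rewrite -tk; apply: tree_arity qi.
    move=> _ /tu-> j qj ji; have [|a [Aa ai aj]] := qsep t i j qi qj; first by move/esym.
    by exists a; split=> //; apply: ir'.
  exists r, 0; split=> //.
  move=> _ /tu-> j qj _.
  have [cj [Acj cjq cjmin]] := envelope cA (through q (j :: t)).
  exists (~` cj)%O; rewrite complK; split=> //; first exact: subalgebra_compl.
  apply/ro_complP => r' r'r cjr'; apply: ni; exists j, r'; split=> // a Aa aj.
  by move/ro_leP: (cjmin a Aa aj); apply.
have [p' [C [p'p CP]]] := bounding dec_down dec_dense p.
have [a [Aa ap' amin]] := envelope cA p'.
have [q' q'q aq'] : exists2 q', q' ≼ q & regopen_set a q'.
  apply: contrapT => h.
  have nac : (c <= ~` a)%O.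
    apply: cmin; first exact: subalgebra_compl.
    by apply/ro_complP => q' q'q aq'; apply: h; exists q'.
  apply: (regopen_compl_absurd ap'); move/ro_leP: nac; apply.
  exact: regopen_down pc.
have [t _ wt] := tree_wide 1 (tree_root q').
have [K [Ku Ks Kq']] := wt.
have [Csz Cdec] := CP (index_of t).
(* At t, q' has more than bound k children, so one of them is excluded below p'. *)
have [i iK iC] : exists2 i, i \in K & i \notin C (index_of t).
  apply: contrapT => h; have : size K <= size (C (index_of t)).
    apply: uniq_leq_size => // i iK; apply: contrapT => /negP iC.
    by apply: h; exists i.
  by move/(leq_trans Ks); rewrite expn1 ltnNge Csz.
have q'i := Kq' i iK; have qi := q'q _ q'i.
have [e [Ae ei emin]] := envelope cA (through q' (i :: t)).
have [p2 p2p' ep2] : exists2 p2, p2 ≼ p' & regopen_set e p2.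
  apply: contrapT => h.
  have nea : (a <= ~` e)%O.
    apply: amin; first exact: subalgebra_compl.
    by apply/ro_complP => p2 p2p' ep2; apply: h; exists p2.
  apply: (regopen_compl_absurd ei); move/ro_leP: nea; apply.
  exact: regopen_down (@through_stronger _ _) aq'.
(* A splitting node of p lies above u, while no node of q does; hence the index
   of t is not that of a splitting node of p. *)
have [s j k st pj pk|r [j [rp2 jC dj]]] := Cdec _ p2 p2p'.
  have /(pcan_inj pickleK) sE := st; rewrite {s st}sE in pj pk.
  apply: contrapT => jk.
  have us : suffix u t.
    have /orP[//|tu] := pu _ (tree_suffix (suffix_cons t j) pj).
    have [<-|/eqP tnu] := eqVneq t u; first exact: suffix_refl.
    case: jk; apply: (compatible_children _ _ tu tnu); rewrite compatible_sym;
      exact: pu.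
  apply: (notin_cone (u := u) _ uq0).
  apply: (tree_suffix us); apply: qq0; apply: tree_suffix qi.
  exact: suffix_cons.
have [b [Ab br bi]] : separated A r (through q (i :: t)).
  by apply: dj => // ij; move: iC; rewrite ij jC.
have enb : (e <= ~` b)%O.
  apply: emin; first exact: subalgebra_compl.
  exact: regopen_down (through_le q'q q'i) bi.
apply: (regopen_compl_absurd br); move/ro_leP: enb; apply.
exact: regopen_down ep2.
Qed.

Theorem mainTheorem2 :
  exists (d : Order.disp_t) (B : ctbDistrLatticeType d),
    simple_cBA B /\ countably_generated B.
Proof.
exists ro_disp, (regopen tree_forcing); split; last exact: trees_generated.
split; [exact: regopen_complete| |exact: trees_atomless|].
  move=> bt; suff : regopen_set (\bot%O : regopen tree_forcing) full by [].
  by rewrite bt.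
by move=> [A [cA atA nA]]; apply/nA/trees_simple.
Qed.
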